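(* For every real $p$ with $1 \leq p < +\infty$, the real Banach space $\ell_p$ satisfies $\Theta_{\ell_p}(n) \simeq n^{-1/p}$; that is, there are constants $c,d>0$ (depending only on $p$) such that $c\, n^{-1/p} \le \Theta_{\ell_p}(n) \le d\, n^{-1/p}$ for all $n \in \mathbb{N}$.
   Context: For a Banach space $X$, $B_X$ is its closed unit ball. For $A \subset X$, the essential inradius $\varrho(A) \in [0,\infty]$ is $$\varrho(A) = \sup\{ r>0 : \exists x \in A,\ \exists Y \subset X \text{ closed subspace with } \dim(X/Y)<\infty,\ x + r B_Y \subset A\},$$ where $B_Y = B_X \cap Y$ (and $\sup \emptyset = 0$). Let $\mathcal{C}(X)$ be the family of bounded closed convex subsets of $X$. The covering index is $$\Theta_X(n) = \inf\Big\{ \max_{1\le k\le n} \varrho(A_k) : (A_k)_{k=1}^n \subset \mathcal{C}(X),\ \bigcup_{k=1}^n A_k = B_X \Big\}, \qquad n \in \mathbb{N}.$$ *)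

(* Defs.v *)
From HB Require Import structures.
From mathcomp Require Import all_boot all_order all_algebra.
From mathcomp Require Import all_classical all_reals all_analysis.

Set Implicit Arguments.
Unset Strict Implicit.
Unset Printing Implicit Defensive.

Import Order.TTheory GRing.Theory Num.Def Num.Theory.
Import numFieldNormedType.Exports.

Local Open Scope classical_set_scope.
Local Open Scope ring_scope.

Section covering_index.
Context {R : realType} (X : completeNormedModType R).

Definition unit_ball : set X := [set x | `|x| <= 1].

Definition linear_subspace (Y : set X) : Prop :=
  Y 0 /\ forall (a : R) (x y : X), Y x -> Y y -> Y (a *: x + y).

(* dim (X / Y) < oo: the quotient X / Y has a finite spanning family, given by
   representatives e i of its members; x and \sum_i c i *: e i have the same
   class iff their difference lies in Y. *)
Definition finite_codim (Y : set X) : Prop :=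
  exists (m : nat) (e : 'I_m -> X), forall x : X,
    exists c : 'I_m -> R, Y (x - \sum_(i < m) c i *: e i).

(* The maximum with 0 is the convention sup set0 = 0: in \bar R the library
   has ereal_sup set0 = -oo. *)
Definition essential_inradius (A : set X) : \bar R :=
  maxe 0%E (ereal_sup [set r%:E | r in [set r : R | 0 < r /\
    exists x, A x /\ exists Y : set X,
      [/\ linear_subspace Y, closed Y, finite_codim Y &
          [set x + r *: y | y in unit_ball `&` Y] `<=` A]]]).

Definition bounded_closed_convex : set (set X) :=
  [set A | [/\ bounded_set A, closed A & convex_set A]].

Definition covering_index (n : nat) : \bar R :=
  ereal_inf [set \big[maxe/-oo%E]_(k < n) essential_inradius (A k) |
    A in [set A : 'I_n -> set X |
      (forall k, bounded_closed_convex (A k)) /\ \bigcup_k A k = unit_ball]].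

End covering_index.

(* The real space l_p.  Every function on nat is measurable, and equality almost
   everywhere for the counting measure is equality, so the functions with a
   finite p-norm are the elements of the space, without a quotient; normr_lpE
   below gives the norm as the usual series. *)
Definition lp {R : realType} {p : R} (p1 : 1 <= p) : Type :=
  LfunType (@counting nat R) (p1 : (1%:E <= p%:E)%E).

Section lp_normed.
Context {R : realType} {p : R} (p1 : 1 <= p).

HB.instance Definition _ := GRing.Lmodule.on (lp p1).

Let p0 : 0 < p. Proof. exact: lt_le_trans ltr01 p1. Qed.

Definition lp_norm (x : lp p1) : R :=
  fine ('N[@counting nat R]_p%:E [EFin \o (x : nat -> R)])%E.

Let Lnorm_leP (x : nat -> R) (e : R) : 0 <= e ->
  ('N[@counting nat R]_p%:E [EFin \o x] <= e%:E)%E <->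
  forall n, \sum_(0 <= k < n) `|x k| `^ p <= e `^ p.
Proof.
move=> e0; rewrite Lnorm_counting//=.
set S := (X in (X `^ _)%E).
have S0 : (0 <= S)%E by apply: nneseries_ge0 => k _ _; rewrite lee_fin powR_ge0.
have -> : (S `^ p^-1 <= e%:E)%E <-> (S <= (e `^ p)%:E)%E.
  split => h.
    rewrite -[S]poweRe1// -(@mulVf _ p) ?gt_eqF// poweRrM -poweR_EFin.
    apply: gt0_ler_poweR => //; first exact: ltW.
    - by rewrite in_itv/= leey andbT poweR_ge0.
    - by rewrite in_itv/= leey andbT lee_fin.
  have -> : e%:E = ((e `^ p)%:E `^ p^-1)%E.
    by rewrite poweR_EFin -powRrM mulfV ?gt_eqF// powRr1.
  apply: gt0_ler_poweR => //; first by rewrite invr_ge0 ltW.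
  - by rewrite in_itv/= leey andbT.
  - by rewrite in_itv/= leey andbT lee_fin powR_ge0.
split => [Se n|Se].
  rewrite -lee_fin -sumEFin; apply: le_trans Se.
  by apply: nneseries_lim_ge => k _ _; rewrite lee_fin powR_ge0.
apply: lime_le.
  by apply: is_cvg_nneseries => k _ _; rewrite lee_fin powR_ge0.
by apply: nearW => n /=; rewrite sumEFin lee_fin.
Qed.

Lemma lp_norm_leP (x : lp p1) (e : R) : 0 <= e ->
  lp_norm x <= e <-> forall n, \sum_(0 <= k < n) `|x k| `^ p <= e `^ p.
Proof. by move=> e0; rewrite -Lnorm_leP// -lee_fin finite_norm_fine. Qed.

Lemma lp_ler_normD (x y : lp p1) : lp_norm (x + y) <= lp_norm x + lp_norm y.
Proof. exact: ler_LnormD. Qed.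

Lemma lp_normZ (a : R) (x : lp p1) : lp_norm (a *: x) = `|a| * lp_norm x.
Proof.
by apply/EFin_inj; rewrite EFinM /lp_norm !finite_norm_fine -LnormZ.
Qed.

Lemma lp_norm_ge0 (x : lp p1) : 0 <= lp_norm x.
Proof. by rewrite fine_ge0// Lnorm_ge0. Qed.

Lemma ler_lp_norm (x : lp p1) k : `|x k| <= lp_norm x.
Proof.
have /lp_norm_leP := lexx (lp_norm x).
move=> /(_ (lp_norm_ge0 x) k.+1) h.
have {}h : `|x k| `^ p <= lp_norm x `^ p.
  apply: le_trans h; rewrite big_nat_recr//= lerDr.
  by apply: sumr_ge0 => i _; exact: powR_ge0.
rewrite leNgt; apply/negP => /(gt0_ltr_powR p0) h'.
by move: h; rewrite leNgt h' // nnegrE ?lp_norm_ge0.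
Qed.

Lemma lp_norm0_eq0 (x : lp p1) : lp_norm x = 0 -> x = 0.
Proof.
move=> x0; apply/val_inj/funext => k /=; apply/eqP.
by rewrite -normr_le0 -x0 ler_lp_norm.
Qed.

HB.instance Definition _ := @Lmodule_isNormed.Build R (lp p1)
  lp_norm lp_ler_normD lp_normZ lp_norm0_eq0.

Lemma normr_lpE (x : lp p1) :
  `|x|%:E = ((\sum_(0 <= k <oo) (`|x k| `^ p)%:E) `^ p^-1)%E.
Proof.
by rewrite -[`|x|]/(lp_norm x) /lp_norm finite_norm_fine Lnorm_counting.
Qed.

Let lpBE (x y : lp p1) k : (x - y) k = x k - y k.
Proof. by []. Qed.

Let continuous_norm_powR : continuous (fun t : R => `|t| `^ p).
Proof.
move=> t; have [->|t0] := eqVneq t 0.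
  rewrite /continuous_at normr0 powR0 ?gt_eqF//.
  apply/cvgr0Pnorm_le => e e0; near=> s.
  rewrite ger0_norm ?powR_ge0//.
  have [->|s0] := eqVneq s 0; first by rewrite normr0 powR0 ?gt_eqF// ltW.
  apply: (@le_trans _ _ `|s|).
    apply: ge1r_powR => //; rewrite normr_gt0 s0/=.
    by near: s; exact: (@nbhs0_le _ R^o _ ltr01).
  by near: s; exact: (@nbhs0_le _ R^o _ e0).
have : {for `|t|, continuous (fun s : R => s `^ p)}.
  apply/differentiable_continuous/derivable1_diffP/derivable_powR.
  by rewrite in_itv/= andbT normr_gt0.
by apply: continuous_comp; exact: norm_continuous.
Unshelve. all: by end_near. Qed.

Lemma lp_complete (F : set_system (lp p1)) : ProperFilter F -> cauchy F -> cvg F.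
Proof.
move=> FF /cauchy_ballP Fc.
have ev k : cvg ((fun x : lp p1 => x k) @ F).
  apply: (@cauchy_cvg R); apply/cauchy_ballP => e e0.
  rewrite near_map2; apply: filterS (Fc _ e0) => -[x z] /=; rewrite -!ball_normE /ball_/=.
  by apply: le_lt_trans; rewrite -lpBE; exact: ler_lp_norm.
pose y k := lim ((fun x : lp p1 => x k) @ F).
have key e : 0 < e -> \forall x \near F,
    forall n, \sum_(0 <= k < n) `|(x : lp p1) k - y k| `^ p <= e `^ p.
  move=> e0; apply: filterS (nearP_dep (Fc _ e0)) => x xF n.
  pose G (z : lp p1) := \sum_(0 <= k < n) `|x k - z k| `^ p.
  apply: (cvgr_to_le (f := G) (F := F)).
    apply: cvg_big => [|k _]; first exact: add_continuous.
    apply: (@cvg_comp _ _ _ (fun z : lp p1 => x k - z k) (fun t => `|t| `^ p));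
      last exact: continuous_norm_powR.
    by apply: cvgB; [exact: cvg_cst|exact: ev].
  apply: filterS xF => z; rewrite -ball_normE /ball_/= => /ltW.
  by move/lp_norm_leP; apply; exact: ltW.
have [x0 hx0] := filter_ex (key _ (@ltr01 R)).
have fy : (fun k : nat => x0 k - y k) \in Lfun (@counting nat R) p%:E.
  rewrite inE; apply/andP; split; rewrite inE//=.
  by rewrite /finite_norm; apply: (@le_lt_trans _ _ 1%:E); [exact/Lnorm_leP|exact: ltry].
pose d : lp p1 := Lfun_Sub (p1 : (1%:E <= p%:E)%E) fy.
apply/cvg_ex; exists (x0 - d).
apply/cvgrPdist_le => e e0; near=> x.
rewrite -normrN opprB; apply/lp_norm_leP; first exact: ltW.
move=> n; suff -> : (x - (x0 - d) : lp p1) = (fun k => x k - y k) :> (nat -> R).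
  by move: n; near: x; exact: key.
apply/funext => k.
by rewrite -[LHS]/(x k - (x0 k - (x0 k - y k))) subKr.
Unshelve. all: by end_near. Qed.

HB.instance Definition _ := Uniform_isComplete.Build (lp p1) lp_complete.

End lp_normed.

(* Main.v *)
Require Import Defs.
From mathcomp Require Import all_boot all_order all_algebra.
From mathcomp Require Import all_classical all_reals all_analysis.
From mathcomp Require Import lra.

(** Upper bound.  Split the coordinates into the n residue classes S_i modulo n
    and let A_i be the set of the x in the unit ball whose restriction to S_i has
    norm at most t = n^(-1/p).  The p-th powers of the n restricted norms add up
    to at most 1, so one of them is at most t^p: the A_i cover the ball
    ([covering_index_le]).  A subspace of finite codimension contains a unit
    vector y supported in the infinite set S_i, and x + r y and x - r y both
    belong to A_i only if r <= t ([slab_inradius]).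

    Lower bound.  Let A_1, ..., A_n be closed convex sets whose essential inradii
    are all below r = (2n)^(-1/p).  A point of the ball outside all of them is
    reached from 0 by leaving the sets one at a time ([avoid_sets]).  If the
    current point x lies in A_i, then since the inradius of A_i is below r, any
    closed subspace Z of finite codimension contains a y of norm at most 1 with
    x + r y outside A_i.  Two requirements are imposed on Z.
    - Its elements vanish on a long initial segment of the coordinates, outside of
      which x is negligible.  Then x and r y are almost disjointly supported, and
      the step increases |x|^p by r^p up to an arbitrarily small error
      ([lt_norm_add_tail]).
    - It is contained in a subspace along which the sets already left are never met
      again.  Such a subspace is kept by intersecting it, each time a set A_i has
      been left, with a closed subspace H of codimension at most 1 such that x + H
      misses A_i; H comes from the separation theorem ([separation]).
    After n steps |x|^p is at most 1/2 + n r^p = 1.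

    The separation theorem is proved through total orders instead of linear
    functionals: a strict cone that contains a neighbourhood of A - x extends to
    the positive cone of a total order, and H is the space of its
    infinitesimals. *)

Import Order.TTheory GRing.Theory Num.Def Num.Theory.
Import numFieldNormedType.Exports.

Local Open Scope classical_set_scope.
Local Open Scope ring_scope.

(** * Convex sets and cones *)

Section convexity.
Context {R : realType} {X : lmodType R}.

Lemma convex_setP (A : set X) : convex_set A <->
  forall (t : R) (x y : X), 0 <= t -> t <= 1 -> A x -> A y ->
    A (t *: x + (1 - t) *: y).
Proof.
split=> [cA t x y t0 t1 Ax Ay|cA x y l xA yA].
  have t01 : Itv.spec (Itv.num_sem (R:=R)) (Itv.Real `[0%Z, 1%Z]) t.
    by rewrite /Itv.spec/= /Itv.num_sem/= num_real/= in_itv/= t0 t1.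
  have := cA x y (Itv.mk t01); rewrite !inE; exact.
apply/mem_set; apply: cA => //; [exact: set_mem xA|exact: set_mem yA].
Qed.

End convexity.

Section cones.
Context {R : realType} {X : lmodType R}.

(** These are the sets of strictly positive elements of the vector space orders. *)
Definition strict_cone (K : set X) : Prop :=
  [/\ ~ K 0, forall x y, K x -> K y -> K (x + y) &
      forall (t : R) x, 0 < t -> K x -> K (t *: x)].

(** Zorn's lemma gives a maximal strict cone K above K0.  If neither x nor - x were
    in K, then adding the ray of x to K would give a larger strict cone: 0 could
    only arise as k + t x with k in K and t > 0, which puts - x in K. *)
Lemma strict_cone_total {K0 : set X} : strict_cone K0 ->
  exists K, [/\ strict_cone K, K0 `<=` K & forall x, x != 0 -> K x \/ K (- x)].
Proof.
move=> cK0.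
(* K0 is put back into each member of P because the empty chain must also have
   its union in P. *)
pose P := [set K : set X | strict_cone (K0 `|` K)].
have [F FP Ftot|K [PK Kmax]] := @Zorn_bigcup X P.
  have F2 x y : (K0 `|` \bigcup_(K in F) K) x -> (K0 `|` \bigcup_(K in F) K) y ->
      exists2 L, strict_cone (K0 `|` L) & [/\ L `<=` \bigcup_(K in F) K,
        (K0 `|` L) x & (K0 `|` L) y].
    move=> [K0x|[K FK Kx]] [K0y|[L FL Ly]].
    - by exists set0; [rewrite setU0|split=> //; left].
    - by exists L; [exact: FP|split; [exact: bigcup_sup|left|right]].
    - by exists K; [exact: FP|split; [exact: bigcup_sup|right|left]].
    - have [KL|LK] := Ftot _ _ FK FL.
        by exists L; [exact: FP|split; [exact: bigcup_sup|right; exact: KL|right]].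
      by exists K; [exact: FP|split; [exact: bigcup_sup|right|right; exact: LK]].
  split=> [h|x y /F2 h /h[L [_ +_] [LF Lx Ly]]|t x t0 h].
  - by have [L [+ _ _] [_ + _]] := F2 _ _ h h.
  - by move=> /(_ _ _ Lx Ly)[|/LF]; [left|right].
  - have [L [_ _ +] [LF Lx _]] := F2 _ _ h h.
    by move=> /(_ t x t0 Lx)[|/LF]; [left|right].
exists (K0 `|` K); split; [exact: PK|exact: subsetUl|].
have [K0' KD KZ] := PK.
move=> x x0; have [Kx|nKx] := pselect ((K0 `|` K) x); [by left|right].
pose Q := [set z | exists2 t : R, 0 < t & z = t *: x \/ exists2 k,
  (K0 `|` K) k & z = k + t *: x].
pose L := Q `|` (K0 `|` K).
have KL : K `<` L.
  split; first by move=> z Kz; right; right.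
  move=> /(_ x) LK; apply: nKx; right; apply: LK.
  by left; exists 1 => //; left; rewrite scale1r.
have := Kmax _ KL; rewrite /P/=.
have -> : K0 `|` L = L by apply/setUidPr => z K0z; right; left.
have LD u v : L u -> L v -> L (u + v).
  have hD w z : Q w -> (K0 `|` K) z -> L (w + z).
    move=> [t t0 [->|[k Kk ->]]] Kz; left; exists t => //; right.
      by exists z => //; rewrite addrC.
    by exists (k + z); [exact: KD|rewrite addrAC].
  move=> [Lu|Ku] [Lv|Kv]; [|exact: hD|by rewrite addrC; exact: hD|by right; exact: KD].
  move: Lu Lv => [t t0 Lu] [s s0 Lv]; left; exists (t + s); first exact: addr_gt0.
  move: Lu Lv => [->|[k Kk ->]] [->|[l Kl ->]].
  - by left; rewrite scalerDl.
  - by right; exists l => //; rewrite addrCA scalerDl.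
  - by right; exists k => //; rewrite -addrA scalerDl.
  - by right; exists (k + l); [exact: KD|rewrite addrACA scalerDl].
have LZ (c : R) u : 0 < c -> L u -> L (c *: u).
  move=> c0 [[t t0 Lu]|Ku]; last by right; exact: KZ.
  left; exists (c * t); first exact: mulr_gt0.
  case: Lu => [->|[k Kk ->]]; first by left; rewrite scalerA.
  by right; exists (c *: k); [exact: KZ|rewrite scalerDr scalerA].
move=> nL; have : L 0 by apply: contrapT => L0; apply: nL.
case=> [[t t0 []]|//].
  by move/esym/eqP; rewrite scaler_eq0 (negbTE x0) orbF gt_eqF.
move=> [k Kk /esym/eqP]; rewrite addrC addr_eq0 => /eqP e.
have -> : - x = t^-1 *: k.
  by rewrite -[k]opprK -e scalerN scalerA mulVf ?gt_eqF// scale1r.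
by apply: KZ => //; rewrite invr_gt0.
Qed.

End cones.

(** * Separation and subspaces of finite codimension *)

Section separation.
Context {R : realType} {X : completeNormedModType R}.

Lemma normed_closedP (A : set X) : closed A <->
  forall x, (forall e : R, 0 < e -> exists2 y, A y & `|x - y| < e) -> A x.
Proof.
split=> [cA x h|h x clx].
  apply: cA => B /nbhs_ballP[e /= e0 eB]; have [y Ay xy] := h _ e0.
  by exists y; split => //; apply: eB; rewrite -ball_normE.
apply: h => e e0; have [y [Ay]] := clx _ (nbhsx_ballx x e e0).
by rewrite -ball_normE /= => xy; exists y.
Qed.

Lemma closed_ler_lipschitz (f : X -> R) (t : R) :
  (forall x y, f x <= f y + `|x - y|) -> closed [set x | f x <= t].
Proof.
move=> fL; apply/normed_closedP => x xt /=; apply/ler_addgt0Pr => e e0.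
have [y /= yt xy] := xt _ e0; apply: le_trans (fL x y) _.
by apply: lerD => //; exact: ltW.
Qed.

Definition codim_le1 (H : set X) : Prop :=
  exists a, forall x, exists c : R, H (x - c *: a).

(** Geometric Hahn-Banach theorem, with a hyperplane direction instead of a
    functional.  Order the space by a total cone K that contains z - x + u for
    all z in A and all small u, fix a in A - x, and let H consist of the z with
    - e a < z < e a for every e > 0.  Since a is an order unit with a whole ball
    around it in K, H is closed, and totality of the order shows that z - c a is
    in H for c the supremum of the t with t a < z.  If y is in A - x, then
    y - e a is positive for small e, so y is not infinitesimal. *)
Lemma separation {A : set X} {x : X} : closed A -> convex_set A -> ~ A x ->
  exists H, [/\ linear_subspace H, closed H, codim_le1 H &
    forall y, H y -> ~ A (x + y)].
Proof.
move=> clA /convex_setP cA nAx.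
have [d d0 dA] : exists2 d : R, 0 < d & forall y, A y -> d <= `|x - y|.
  move/normed_closedP: clA => clA; apply: contrapT => nd; apply: nAx.
  apply: clA => e e0.
  apply: contrapT => ne; apply: nd; exists e => // y Ay.
  by rewrite leNgt; apply/negP => xy; apply: ne; exists y.
have [[y0 Ay0]|A0] := pselect (A !=set0); last first.
  exists setT; split => //; first by exists 0 => z; exists 0.
  by move=> y _ Axy; apply: A0; exists (x + y).
pose K0 := [set z | exists t y u,
  [/\ 0 < t :> R, A y, `|u| < d & z = t *: (y - x + u)]].
have /strict_cone_total[K [[K00 KD KZ] K0K Ktot]] : strict_cone K0.
  split.
  - move=> [t [y [u [t0 Ay ud /esym/eqP]]]].
    rewrite scaler_eq0 gt_eqF//= => /eqP e.
    have := dA _ Ay; rewrite leNgt; suff -> : x - y = u by rewrite ud.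
    by rewrite -opprB; apply/esym/eqP; rewrite -addr_eq0 addrC e.
  - move=> _ _ [t [y [u [t0 Ay ud ->]]]] [s [z [v [s0 Az vd ->]]]].
    have ts0 : 0 < t + s by exact: addr_gt0.
    have tsE : (t + s) * (t / (t + s)) = t by rewrite mulrC divfK ?gt_eqF.
    have tsE' : (t + s) * (1 - t / (t + s)) = s by rewrite mulrBr mulr1 tsE addrC addKr.
    have l0 : 0 <= t / (t + s) by rewrite divr_ge0 ?ltW.
    have l1 : t / (t + s) <= 1 by rewrite ler_pdivrMr// mul1r lerDl ltW.
    set l := t / (t + s) in tsE tsE' l0 l1.
    clearbody l.
    exists (t + s), (l *: y + (1 - l) *: z), (l *: u + (1 - l) *: v); split => //.
    + exact: cA.
    + apply: le_lt_trans (ler_normD _ _) _; rewrite !normrZ.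
      rewrite (ger0_norm l0) ger0_norm ?subr_ge0//.
      have [le|le] := ltP `|u| `|v|; nra.
    + have -> : l *: y + (1 - l) *: z - x + (l *: u + (1 - l) *: v) =
          l *: (y - x + u) + (1 - l) *: (z - x + v).
        have {1}-> : x = l *: x + (1 - l) *: x by rewrite -scalerDl addrC subrK scale1r.
        by rewrite opprD [X in X + _]addrACA -!scalerBr addrACA -!scalerDr.
      by rewrite [RHS]scalerDr !scalerA tsE tsE'.
  - move=> s _ s0 [t [y [u [t0 Ay ud ->]]]]; exists (s * t), y, u.
    by split => //; [exact: mulr_gt0|rewrite scalerA].
pose a := y0 - x.
have Ka (e : R) u : 0 < e -> `|u| < e * d -> K (e *: a + u).
  move=> e0 ue; apply: K0K; exists e, y0, (e^-1 *: u); split => //.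
    by rewrite normrZ gtr0_norm ?invr_gt0// mulrC ltr_pdivrMr// mulrC.
  by rewrite [RHS]scalerDr scalerA mulfV ?gt_eqF// scale1r.
clearbody a.
have Kea (e : R) : 0 < e -> K (e *: a).
  by move=> e0; rewrite -[_ *: a]addr0; apply: Ka => //; rewrite normr0 mulr_gt0.
have KN z : K z -> ~ K (- z) by move=> Kz /(KD _ _ Kz); rewrite subrr.
pose H := [set z : X | forall e : R, 0 < e -> K (e *: a - z) /\ K (e *: a + z)].
have HN z : H z -> H (- z) by move=> Hz e e0; rewrite opprK; have [] := Hz _ e0.
have e2 (e : R) z w : (e / 2) *: a + z + ((e / 2) *: a + w) = e *: a + (z + w).
  by rewrite addrACA -scalerDl -splitr.
have HD z w : H z -> H w -> H (z + w).
  move=> Hz Hw e e0; have e20 : 0 < e / 2 by rewrite divr_gt0.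
  have [z1 z2] := Hz _ e20; have [w1 w2] := Hw _ e20.
  by rewrite opprD -!e2; split; exact: KD.
have HZp (c : R) z : 0 < c -> H z -> H (c *: z).
  move=> c0 Hz e e0; have [] := Hz (c^-1 * e); first by rewrite mulr_gt0 ?invr_gt0.
  move=> /(KZ c _ c0) + /(KZ c _ c0).
  by rewrite scalerBr scalerDr scalerA mulVKf ?gt_eqF.
have H0 : H 0 by move=> e e0; rewrite subr0 addr0; split; exact: Kea.
have HZ (c : R) z : H z -> H (c *: z).
  move=> Hz; have [c0|c0|->] := ltrgtP c 0; [|exact: HZp|by rewrite scale0r].
  by rewrite -[c]opprK scaleNr; apply: HN; apply: HZp => //; rewrite oppr_gt0.
exists H; split.
- by split=> // c z w Hz Hw; apply: HD => //; exact: HZ.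
- apply/normed_closedP => z zH.
  suff h w : (forall e : R, 0 < e -> exists2 y, H y & `|w - y| < e) ->
      forall e : R, 0 < e -> K (e *: a + w).
    move=> e e0; split; apply: h => // e' e'0; have [y Hy zy] := zH _ e'0.
    by exists (- y); [exact: HN|rewrite -opprD normrN].
  move=> hw e e0; have e20 : 0 < e / 2 by rewrite divr_gt0.
  have [|y Hy wy] := hw (e / 2 * d); first exact: mulr_gt0.
  rewrite -[w](subrK y) -e2; apply: KD; first exact: Ka.
  by have [] := Hy _ e20.
- exists a => z.
  have zK (t : R) : `|z| < t * d -> K (t *: a + z) /\ K (t *: a - z).
    move=> zt; have t0 : 0 < t by rewrite -(pmulr_lgt0 _ d0) (le_lt_trans _ zt).
    by split; apply: Ka => //; rewrite normrN.
  pose T := [set t : R | K (z - t *: a)].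
  pose s := (`|z| + 1) / d.
  have sz : `|z| < s * d by rewrite /s divfK ?gt_eqF// ltrDl.
  have T0 : T !=set0.
    by exists (- s); rewrite /T/= scaleNr opprK addrC; have [] := zK s sz.
  have Tub : ubound T s.
    move=> t Tt; rewrite leNgt; apply/negP => st.
    have [|_ /KN] := zK t; first by apply: lt_trans sz _; rewrite ltr_pM2r.
    by rewrite opprB => /(_ Tt).
  have hT : has_sup T by split => //; exists s.
  exists (sup T) => e e0; have e20 : 0 < e / 2 by rewrite divr_gt0.
  split; last first.
    have [t Tt et] := sup_adherent e0 hT.
    have -> : e *: a + (z - sup T *: a) = (z - t *: a) + (t - (sup T - e)) *: a.
      by rewrite 2!scalerBl opprB [RHS]addrA subrK addrCA.
    by apply: KD => //; apply: Kea; rewrite subr_gt0.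
  have -> : e *: a - (z - sup T *: a) =
      (e / 2) *: a + ((sup T + e / 2) *: a - z).
    rewrite {1}(splitr e) !scalerDl opprB -!addrA; congr (_ + _).
    by rewrite addrCA.
  have [->|n0] := eqVneq ((sup T + e / 2) *: a - z) 0; first by rewrite addr0; exact: Kea.
  have [Kz|] := Ktot _ n0; first by apply: KD => //; exact: Kea.
  rewrite opprB => Tz; have := ub_le_sup (proj2 hT) Tz.
  by rewrite gerDl leNgt e20.
- move=> y Hy Axy.
  pose e := d / (2 * (`|a| + 1)).
  have a1 : 0 < `|a| + 1 by rewrite ltr_wpDl.
  have e0 : 0 < e by rewrite divr_gt0// mulr_gt0.
  have [/KN + _] := Hy _ e0; apply; rewrite opprB.
  apply: K0K; exists 1, (x + y), (- (e *: a)); split => //; last first.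
    by rewrite scale1r [x + y]addrC addrK.
  rewrite normrN normrZ gtr0_norm// /e mulrAC ltr_pdivrMr ?mulr_gt0//.
  rewrite ltr_pM2l//; have := normr_ge0 a; lra.
Qed.

Lemma linear_subspaceD {Y : set X} x y : linear_subspace Y -> Y x -> Y y -> Y (x + y).
Proof. by move=> [_ h] Yx Yy; rewrite -[x]scale1r; exact: h. Qed.

Lemma linear_subspaceZ {Y : set X} (c : R) x : linear_subspace Y -> Y x -> Y (c *: x).
Proof. by move=> [Y0 h] Yx; rewrite -[_ *: _]addr0; exact: h. Qed.

(** If Y is not contained in H, then some y in Y is a nonzero multiple of a modulo H,
    so y can serve as the direction complementary to H; subtracting multiples of
    it from elements of Y does not leave Y. *)
Lemma finite_codimI {Y H : set X} : linear_subspace Y -> linear_subspace H ->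
  finite_codim Y -> codim_le1 H -> finite_codim (Y `&` H).
Proof.
move=> lY lH [m [e eY]] [a aH].
have [YH|/existsNP[y /not_implyP[Yy nHy]]] := pselect (Y `<=` H).
  by exists m, e => x; have [c Yc] := eY x; exists c; split => //; exact: YH.
exists m.+1, (fun i => oapp e y (unlift ord0 i)) => x.
have [c Yc] := eY x; set z := x - _ in Yc.
have [s Hs] := aH z; have [t Ht] := aH y.
have t0 : t != 0 by apply/eqP => t0; move: Ht; rewrite t0 scale0r subr0.
exists (fun i => oapp c (s / t) (unlift ord0 i)).
rewrite big_ord_recl unlift_none/=.
under eq_bigr do rewrite !liftK/=.
rewrite opprD addrCA addrC -/z; split.
  apply: linear_subspaceD => //; rewrite -scaleNr; exact: linear_subspaceZ.
have -> : z - s / t *: y = z - s *: a + (- (s / t)) *: (y - t *: a).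
  rewrite scalerBr !scaleNr opprK scalerA divfK// addrACA [- (s *: a) + _]addrC.
  by rewrite subrr addr0.
by apply: linear_subspaceD => //; exact: linear_subspaceZ.
Qed.

Lemma linear_subspaceI {Y H : set X} :
  linear_subspace Y -> linear_subspace H -> linear_subspace (Y `&` H).
Proof.
move=> [Y0 hY] [H0 hH]; split=> // a x y [Yx Hx] [Yy Hy].
by split; [exact: hY|exact: hH].
Qed.

(** One vector more than a spanning family of the quotient by Y has makes a family
    that is linearly dependent modulo Y: the matrix of its coordinates in the
    quotient has more rows than columns. *)
Lemma finite_codim_comb {Y : set X} : linear_subspace Y -> finite_codim Y ->
  exists N, forall f : 'I_N -> X, exists2 v : 'I_N -> R,
    (exists i, v i != 0) & Y (\sum_(i < N) v i *: f i).
Proof.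
move=> lY [m [e eY]]; exists m.+1 => f.
have /choice[c cY] i := eY (f i).
pose M : 'M[R]_(m.+1, m) := \matrix_(i, j) c i j.
have kM : kermx M != 0.
  rewrite kermx_eq0 /row_free; apply/eqP => h.
  by have := rank_leq_col M; rewrite h ltnn.
have [u /sub_kermxP uM u0] := rowV0Pn kM.
exists (fun i => u 0 i).
  by have /rV0Pn[i ui] := u0; exists i.
have -> : \sum_(i < m.+1) u 0 i *: f i =
    \sum_(i < m.+1) u 0 i *: (f i - \sum_(j < m) c i j *: e j).
  under [RHS]eq_bigr do rewrite scalerBr scaler_sumr.
  rewrite sumrB exchange_big/= [X in _ - X]big1 ?subr0// => j _.
  under eq_bigr do rewrite scalerA.
  rewrite -scaler_suml; have /matrixP/(_ 0 j) := uM; rewrite !mxE => uj.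
  suff -> : \sum_i u 0 i * c i j = 0 by rewrite scale0r.
  by rewrite -[RHS]uj; apply: eq_bigr => i _; rewrite mxE.
elim/big_ind : _ => [|x y|i _]; [by case: lY|exact: linear_subspaceD|].
exact: linear_subspaceZ.
Qed.

End separation.

(** * Coordinates in the sequence spaces *)

Section lp_sequences.
Context {R : realType} {p : R} (p1 : 1 <= p).
Local Notation lp := (lp p1).
Implicit Types x y z : lp.

Let p0 : 0 < p. Proof. exact: lt_le_trans ltr01 p1. Qed.

Lemma lp_ext x y : (forall k, x k = y k) -> x = y.
Proof. by move=> xy; apply/val_inj/funext. Qed.

Lemma lpD x y k : (x + y) k = x k + y k. Proof. by []. Qed.
Lemma lpZ (a : R) x k : (a *: x) k = a * x k. Proof. by []. Qed.
Lemma lpB x y k : (x - y) k = x k - y k. Proof. by []. Qed.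

Lemma lp_sum (I : finType) (F : I -> lp) k : (\sum_i F i) k = \sum_i F i k.
Proof. by apply: (big_morph (fun x : lp => x k)). Qed.

Lemma ler_coord x k : `|x k| <= `|x|.
Proof. exact: ler_lp_norm. Qed.

Lemma powRK (t : R) : 0 <= t -> (t `^ p^-1) `^ p = t.
Proof. by move=> t0; rewrite -powRrM mulVf ?gt_eqF// powRr1. Qed.

Lemma ler_powR_base (s t : R) : 0 <= s -> 0 <= t -> (s `^ p <= t `^ p) = (s <= t).
Proof.
move=> s0 t0; apply/idP/idP => [|st]; last first.
  by apply: ge0_ler_powR => //; rewrite ?nnegrE // ltW.
by rewrite !leNgt; apply: contra => ts; exact: gt0_ltr_powR.
Qed.

Lemma ltr_powR_base (s t : R) : 0 <= s -> 0 <= t -> (s `^ p < t `^ p) = (s < t).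
Proof. by move=> s0 t0; rewrite !ltNge ler_powR_base. Qed.

Lemma norm_powRP x (t : R) : 0 <= t ->
  `|x| `^ p <= t <-> forall n, \sum_(0 <= k < n) `|x k| `^ p <= t.
Proof.
move=> t0; rewrite -{1 2}(powRK _ t0) ler_powR_base ?powR_ge0//.
exact: lp_norm_leP (powR_ge0 _ _).
Qed.

Lemma bounded_sums_Lfun (f : nat -> R) (t : R) :
  (forall n, \sum_(0 <= k < n) `|f k| `^ p <= t) ->
  f \in Lfun (@counting nat R) p%:E.
Proof.
move=> ft; rewrite inE; apply/andP; split; rewrite inE//=.
rewrite /finite_norm Lnorm_counting// poweR_lty//.
apply: (@le_lt_trans _ _ t%:E); last exact: ltry.
apply: lime_le.
  by apply: is_cvg_nneseries => k _ _; rewrite lee_fin powR_ge0.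
by apply: nearW => n /=; rewrite sumEFin lee_fin.
Qed.

Fact lp_restrict_subproof (S : pred nat) x :
  (fun k => if S k then x k else 0) \in Lfun (@counting nat R) p%:E.
Proof.
apply: (@bounded_sums_Lfun _ (`|x| `^ p)) => n.
have /norm_powRP := lexx (`|x| `^ p).
move=> /(_ (powR_ge0 _ _)) /(_ n); apply: le_trans.
apply: ler_sum => k _; case: ifP => // _.
by rewrite normr0 powR0 ?gt_eqF// powR_ge0.
Qed.

Definition lp_restrict (S : pred nat) x : lp :=
  Lfun_Sub (p1 : (1%:E <= p%:E)%E) (lp_restrict_subproof S x).

Lemma lp_restrictE S x k : lp_restrict S x k = if S k then x k else 0.
Proof. by []. Qed.

Fact unit_vector_subproof (i : nat) :
  (fun k => (k == i)%:R) \in Lfun (@counting nat R) p%:E.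
Proof.
apply: (@bounded_sums_Lfun _ 1) => n.
have [ni|ni] := ltnP i n.
  rewrite big_mkord (bigD1 (Ordinal ni))//= eqxx normr1 powR1 big1 ?addr0// => j.
  rewrite -val_eqE/= => /negbTE ->.
  by rewrite normr0 powR0 ?gt_eqF.
rewrite big1_seq// => j /andP[_]; rewrite mem_index_iota => /andP[_ jn].
by rewrite ltn_eqF ?normr0 ?powR0 ?gt_eqF// (leq_trans jn).
Qed.

Definition unit_vector (i : nat) : lp :=
  Lfun_Sub (p1 : (1%:E <= p%:E)%E) (unit_vector_subproof i).

Lemma unit_vectorE i k : unit_vector i k = (k == i)%:R.
Proof. by []. Qed.

Lemma ler_norm_lp_restrict S x : `|lp_restrict S x| <= `|x|.
Proof.
rewrite -ler_powR_base//; apply/norm_powRP; first exact: powR_ge0.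
move=> n; have /norm_powRP := lexx (`|x| `^ p).
move=> /(_ (powR_ge0 _ _)) /(_ n); apply: le_trans.
apply: ler_sum => k _; rewrite lp_restrictE; case: ifP => // _.
by rewrite normr0 powR0 ?gt_eqF// powR_ge0.
Qed.

Lemma lp_restrictD S x y : lp_restrict S (x + y) = lp_restrict S x + lp_restrict S y.
Proof. by apply: lp_ext => k; rewrite lpD !lp_restrictE; case: ifP; rewrite ?addr0. Qed.

Lemma lp_restrictZ S (a : R) x : lp_restrict S (a *: x) = a *: lp_restrict S x.
Proof. by apply: lp_ext => k; rewrite lpZ !lp_restrictE; case: ifP; rewrite ?mulr0. Qed.

Lemma lp_restrictB S x y : lp_restrict S (x - y) = lp_restrict S x - lp_restrict S y.
Proof. by rewrite lp_restrictD -scaleN1r lp_restrictZ scaleN1r. Qed.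

(** If the initial segment of length N carries almost all of the norm of x, then the
    rest z of x has norm at most d, a y supported beyond N satisfies
    |x + y|^p <= |x|^p + |z + y|^p <= |x|^p + (d + b)^p, and d is chosen such that
    (d + b)^p is b^p plus half of the gap between |x|^p and a. *)
Lemma lt_norm_add_tail {x} {a b : R} : 0 <= b -> `|x| `^ p < a ->
  exists N, forall y, (forall k, (k < N)%N -> y k = 0) -> `|y| <= b ->
    `|x + y| `^ p < a + b `^ p.
Proof.
move=> b0 xa.
pose e := a - `|x| `^ p.
have e0 : 0 < e by rewrite subr_gt0.
pose s := (b `^ p + e / 2) `^ p^-1.
have be0 : 0 <= b `^ p + e / 2 by rewrite addr_ge0 ?powR_ge0// ltW// divr_gt0.
have sp : s `^ p = b `^ p + e / 2 by rewrite powRK.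
have s0 : 0 <= s by exact: powR_ge0.
have bs : b < s by rewrite -ltr_powR_base// sp ltrDl divr_gt0.
pose d := s - b.
have d0 : 0 < d by rewrite subr_gt0.
have dp0 : 0 < d `^ p by rewrite powR_gt0.
have [N xN] : exists N, `|x| `^ p - d `^ p < \sum_(0 <= k < N) `|x k| `^ p.
  apply: contrapT => /forallNP nN.
  (* The maximum with 0 only serves the sign condition of [norm_powRP]: the empty
     sum excludes that it is attained at 0. *)
  have h n : \sum_(0 <= k < n) `|x k| `^ p <= maxr 0 (`|x| `^ p - d `^ p).
    by rewrite le_max; apply/orP; right; rewrite leNgt; apply/negP; exact: nN.
  have m0 : 0 <= maxr 0 (`|x| `^ p - d `^ p) by rewrite le_max lexx.
  have := proj2 (norm_powRP x _ m0) h.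
  rewrite le_max => /orP[|]; last by rewrite lerDl oppr_ge0 leNgt dp0.
  move=> x0; have := nN 0%N; rewrite big_geq//; apply.
  by rewrite subr_lt0 (le_lt_trans x0).
exists N => y y0 yb.
pose z := lp_restrict (fun k => N <= k)%N x.
have zE k : z k = if (N <= k)%N then x k else 0 by [].
have zd : `|z| <= d.
  rewrite -ler_powR_base ?(ltW d0)//; apply/norm_powRP; first exact: ltW.
  move=> n.
  have [nN|Nn] := leqP n N.
    rewrite big1_seq ?(ltW dp0)// => k /andP[_]; rewrite mem_index_iota => /andP[_ kn].
    by rewrite zE leqNgt (leq_trans kn nN)/= normr0 powR0 ?gt_eqF.
  have head0 : \sum_(0 <= k < N) `|z k| `^ p = 0.
    rewrite big1_seq// => k /andP[_]; rewrite mem_index_iota => /andP[_ kn].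
    by rewrite zE leqNgt kn/= normr0 powR0 ?gt_eqF.
  have tailE : \sum_(N <= k < n) `|z k| `^ p = \sum_(N <= k < n) `|x k| `^ p.
    by apply: eq_big_nat => k /andP[Nk _]; rewrite zE Nk.
  have /norm_powRP : `|x| `^ p <= `|x| `^ p by [].
  move=> /(_ (powR_ge0 _ _) n).
  clearbody z; rewrite !(big_cat_nat (leq0n N) (ltnW Nn))/= head0 add0r tailE => h.
  rewrite -(lerD2l (\sum_(0 <= k < N) `|x k| `^ p)).
  by apply: le_trans h _; rewrite -lerBlDr ltW.
have zy : `|z + y| <= s.
  by apply: le_trans (ler_normD _ _) _; rewrite /d in zd; lra.
apply: (@le_lt_trans _ _ (`|x| `^ p + s `^ p)); last first.
  by rewrite sp /e; move: (`|x| `^ p) xa => u; lra.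
apply/norm_powRP; first by rewrite addr_ge0 ?powR_ge0.
have xle := proj1 (norm_powRP x _ (powR_ge0 _ _)) (lexx _).
have zyle := proj1 (norm_powRP (z + y) _ (powR_ge0 _ _)) (lexx _).
move=> n.
apply: (@le_trans _ _ (\sum_(0 <= k < n) `|x k| `^ p +
    \sum_(0 <= k < n) `|(z + y) k| `^ p)).
  rewrite -big_split; apply: ler_sum => k _; rewrite !lpD zE.
  case: ifPn => [_|]; first by rewrite lerDr powR_ge0.
  by rewrite -ltnNge => kN; rewrite y0// addr0 lerDl powR_ge0.
apply: lerD; first exact: xle.
by apply: le_trans (zyle n) _; rewrite ler_powR_base.
Qed.

End lp_sequences.

(** * Bounds for the essential inradius *)

Section essential_inradius_bounds.
Context {R : realType} {X : completeNormedModType R}.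

Lemma essential_inradius_le (A : set X) (t : R) : 0 <= t ->
  (forall (r : R) (x : X) (Y : set X), 0 < r -> linear_subspace Y -> finite_codim Y ->
    (forall y, Y y -> `|y| <= 1 -> A (x + r *: y)) -> r <= t) ->
  (essential_inradius A <= t%:E)%E.
Proof.
move=> t0 h; rewrite /essential_inradius ge_max lee_fin t0/=.
apply: ge_ereal_sup => _ [r [r0 [x [Ax [Y [lY _ fY YA]]]]] <-].
by rewrite lee_fin; apply: (h r x Y) => // y Yy y1; apply: YA; exists y.
Qed.

Lemma essential_inradius_escape {A : set X} {r : R} {x : X} {Y : set X} :
  0 < r -> (essential_inradius A < r%:E)%E -> A x ->
  linear_subspace Y -> closed Y -> finite_codim Y ->
  exists y, [/\ Y y, `|y| <= 1 & ~ A (x + r *: y)].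
Proof.
move=> r0 Ar Ax lY cY fY; apply: contrapT => ny.
move: Ar; apply/negP; rewrite -leNgt /essential_inradius le_max; apply/orP; right.
apply: ereal_sup_ubound; exists r => //; split=> //; exists x; split => //.
exists Y; split=> // _ [y [y1 Yy] <-]; apply: contrapT => nA.
by apply: ny; exists y.
Qed.

End essential_inradius_bounds.

(** * The two bounds for the covering index *)

Section bounds.
Context {R : realType} {p : R} (p1 : 1 <= p).
Local Notation lp := (lp p1).

Let p0 : 0 < p. Proof. exact: lt_le_trans ltr01 p1. Qed.

Definition slab (S : pred nat) (t : R) : set lp :=
  [set x | `|x| <= 1 /\ `|lp_restrict p1 S x| <= t].

Lemma slab_bounded_closed_convex S t : bounded_closed_convex (slab S t).
Proof.
split.
- exists 1; split; first exact: num_real.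
  by move=> M M1 x [x1 _]; exact: le_trans x1 (ltW M1).
- have -> : slab S t = [set x | `|x| <= 1] `&` [set x | `|lp_restrict p1 S x| <= t] by [].
  apply: closedI; apply: closed_ler_lipschitz => x y.
    by rewrite -{1}[x](subrK y) addrC; exact: ler_normD.
  apply: le_trans (lerD (lexx _) (ler_norm_lp_restrict p1 S (x - y))).
  rewrite lp_restrictB -{1}[lp_restrict p1 S x](subrK (lp_restrict p1 S y)) addrC.
  exact: ler_normD.
- apply/convex_setP => l x y l0 l1 [x1 xt] [y1 yt].
  have cvx (u v : lp) s : `|u| <= s -> `|v| <= s -> `|l *: u + (1 - l) *: v| <= s.
    move=> us vs; apply: le_trans (ler_normD _ _) _.
    rewrite !normrZ ger0_norm// ger0_norm ?subr_ge0//; nra.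
  by split; [exact: cvx|rewrite lp_restrictD !lp_restrictZ; exact: cvx].
Qed.

(** The vectors of the standard basis at the indices s i supply arbitrarily many
    independent vectors supported in S, and enough of them have a nontrivial
    combination in Y. *)
Lemma exists_unit_supported {S : pred nat} {s : nat -> nat} {Y : set lp} :
  injective s -> (forall i, S (s i)) -> linear_subspace Y -> finite_codim Y ->
  exists y, [/\ Y y, `|y| = 1 & lp_restrict p1 S y = y].
Proof.
move=> sI sS lY fY.
have [N h] := finite_codim_comb lY fY.
have [v [i vi] Yw] := h (fun i => unit_vector p1 (s i)).
set w := \sum_(i < N) _ in Yw.
have wE k : w k = \sum_(i < N) v i * (k == s i)%:R.
  by rewrite /w lp_sum; apply: eq_bigr => j _; rewrite lpZ unit_vectorE.
have w0 : w != 0.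
  apply/eqP => w0; move: vi; apply/negP/negPn/eqP.
  have : w (s i) = 0 by rewrite w0.
  rewrite wE (bigD1 i)//= eqxx mulr1 big1 ?addr0// => j ji.
  by rewrite (inj_eq sI) val_eqE eq_sym (negbTE ji) mulr0.
have Sw : lp_restrict p1 S w = w.
  apply: lp_ext => k; rewrite lp_restrictE; case: ifPn => // nSk.
  rewrite wE big1// => j _; have [ks|_] := eqVneq k (s j); last by rewrite mulr0.
  by move: nSk; rewrite ks sS.
exists (`|w|^-1 *: w); split; first exact: linear_subspaceZ.
  by rewrite normrZ normfV normr_id mulVf// normr_eq0.
by rewrite lp_restrictZ Sw.
Qed.

(** Both x + r y and x - r y are in the slab for some unit vector y in Y supported in
    S, and the restriction to S of their difference is 2 r y. *)
Lemma slab_inradius (S : pred nat) (s : nat -> nat) (t : R) :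
  injective s -> (forall i, S (s i)) -> 0 <= t ->
  (essential_inradius (slab S t) <= t%:E)%E.
Proof.
move=> sI sS t0; apply: essential_inradius_le => // r x Y r0 lY fY YA.
have [y [Yy y1 Sy]] := exists_unit_supported sI sS lY fY.
have YNy : Y (- y) by rewrite -scaleN1r; exact: linear_subspaceZ.
have [_ rp] : slab S t (x + r *: y) by apply: YA => //; rewrite y1.
have [_ rn] : slab S t (x + r *: (- y)) by apply: YA => //; rewrite normrN y1.
move: rp rn; rewrite !lp_restrictD !lp_restrictZ -scaleN1r lp_restrictZ Sy.
rewrite scaleN1r scalerN => rp rn.
have : `|2 *: (r *: y)| <= t + t.
  have -> : 2 *: (r *: y) = (lp_restrict p1 S x + r *: y) - (lp_restrict p1 S x - r *: y).
    by rewrite opprB addrC subrKA -mulr2n scaler_nat.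
  by apply: le_trans (ler_normB _ _) _; exact: lerD.
by rewrite !normrZ y1 mulr1 normr_nat (gtr0_norm r0); lra.
Qed.

(** The residue classes partition the coordinates.  The sums are compared on a
    common initial segment of length M, long enough for each of the n restricted
    norms to exceed t already there. *)
Lemma lt_norm_of_blocks (n : nat) (x : lp) (t : R) : 0 <= t ->
  (forall i : 'I_n, t < `|lp_restrict p1 (fun k => k %% n == i)%N x|) ->
  (0 < n)%N -> n%:R * t `^ p < `|x| `^ p.
Proof.
move=> t0 tx n0.
have /choice[N hN] : forall i : 'I_n, exists N,
    t `^ p < \sum_(0 <= k < N) `|lp_restrict p1 (fun k => k %% n == i)%N x k| `^ p.
  move=> i; apply: contrapT => /forallNP h; have := tx i; apply/negP; rewrite -leNgt.
  rewrite -(ler_powR_base p1)//; apply/norm_powRP; first exact: powR_ge0.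
  by move=> m; rewrite leNgt; apply/negP; exact: h.
pose M := (\max_(i < n) N i)%N.
have NM i : (N i <= M)%N by exact: leq_bigmax.
apply: (@lt_le_trans _ _ (\sum_(i < n) \sum_(0 <= k < M)
    `|lp_restrict p1 (fun k => k %% n == i)%N x k| `^ p)).
  have -> : n%:R * t `^ p = \sum_(i < n) t `^ p by rewrite sumr_const card_ord mulr_natl.
  apply: ltr_sum => [|i _].
    by apply/hasP; exists (Ordinal n0) => //; rewrite mem_index_enum.
  apply: lt_le_trans (hN i) _.
  rewrite [leRHS](big_cat_nat (leq0n (N i)) (NM i))/= lerDl.
  by apply: sumr_ge0 => k _; exact: powR_ge0.
rewrite exchange_big/=.
apply: le_trans _ (proj1 (norm_powRP p1 x _ (powR_ge0 _ _)) (lexx _) M).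
apply: ler_sum => k _.
rewrite (bigD1 (Ordinal (ltn_pmod k n0)))//= eqxx big1 ?addr0// => i ki.
have /negbTE -> : (k %% n)%N != i by move: ki; rewrite -val_eqE/= eq_sym.
by rewrite normr0 powR0 ?gt_eqF.
Qed.

Lemma covering_index_le (n : nat) : (0 < n)%N ->
  (covering_index lp n <= (n%:R `^ (- p^-1))%:E)%E.
Proof.
move=> n0; set t := _ `^ _.
have t0 : 0 <= t by exact: powR_ge0.
have tp : n%:R * t `^ p = 1.
  rewrite /t -powRrM mulNr mulVf ?gt_eqF// powRN powRr1// mulfV// pnatr_eq0.
  by rewrite -lt0n.
pose A (i : 'I_n) := slab (fun k => k %% n == i)%N t.
apply: ge_ereal_inf; exists (\big[maxe/-oo%E]_(i < n) essential_inradius (A i)).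
  exists A => //; split; first by move=> i; exact: slab_bounded_closed_convex.
  apply/seteqP; split=> [x [i _ []]//|x x1].
  apply: contrapT => nx.
  have : n%:R * t `^ p < `|x| `^ p.
    apply: lt_norm_of_blocks => // i; rewrite ltNge; apply/negP => xt.
    by apply: nx; exists i.
  rewrite tp ltNge; apply/negP/negPn.
  by move: x1; rewrite /unit_ball/= -(ler_powR_base p1)// powR1.
apply: bigmax_le; first exact: leNye.
move=> i _; apply: (@slab_inradius _ (fun j => j * n + i)%N) => //.
  by move=> a b /addIn/eqP; rewrite eqn_pmul2r// => /eqP.
by move=> j; rewrite modnMDl modn_small.
Qed.

Lemma tail_subspace (Y : set lp) (N : nat) :
  linear_subspace Y -> closed Y -> finite_codim Y ->
  exists Z, [/\ Z `<=` Y, linear_subspace Z, closed Z, finite_codim Z &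
    forall z, Z z -> forall k, (k < N)%N -> z k = 0].
Proof.
move=> lY cY fY; elim: N => [|N [Z [ZY lZ cZ fZ ZN]]]; first by exists Y; split.
pose H : set lp := [set x | x N = 0].
have lH : linear_subspace H.
  split=> // a x y; rewrite /H /mkset lpD lpZ => -> ->.
  by rewrite mulr0 addr0.
have cH : closed H.
  have -> : H = [set x | `|x N| <= 0].
    by apply/seteqP; split => x /=; [move=> ->; rewrite normr0|rewrite normr_le0 => /eqP].
  apply: closed_ler_lipschitz => x y.
  apply: le_trans (lerD (lexx _) (ler_coord p1 (x - y) N)).
  by rewrite lpB -{1}[x N](subrK (y N)) addrC; exact: ler_normD.
have eH : codim_le1 H.
  exists (unit_vector p1 N) => x; exists (x N).
  by rewrite /H /mkset lpB lpZ unit_vectorE eqxx mulr1 subrr.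
exists (Z `&` H); split.
- by move=> x [/ZY].
- exact: linear_subspaceI.
- exact: closedI.
- exact: finite_codimI.
- move=> z [Zz Hz] k; rewrite ltnS leq_eqVlt => /orP[/eqP ->//|kN].
  exact: ZN.
Qed.

(** The sets are left in the order of their indices.  The point reached after m steps
    comes with a subspace Y of finite codimension such that moving along Y never
    meets the first m sets again.  The strict inequality for the norm leaves the
    room that the almost disjoint sum in each step needs. *)
Lemma avoid_sets (n : nat) (A : 'I_n -> set lp) (a r : R) : 0 < a -> 0 < r ->
  (forall i, closed (A i)) -> (forall i, convex_set (A i)) ->
  (forall i, (essential_inradius (A i) < r%:E)%E) ->
  exists2 x : lp, `|x| `^ p < a + n%:R * r `^ p & forall i, ~ A i x.
Proof.
move=> a0 r0 clA cvA Ar.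
suff /(_ n (leqnn n)) [x [Y [[Y0 _] _ _ xa xA]]] : forall m, (m <= n)%N ->
    exists x Y, [/\ linear_subspace Y, closed Y, finite_codim Y,
      `|x| `^ p < a + m%:R * r `^ p &
      forall i : 'I_n, (i < m)%N -> forall y, Y y -> ~ A i (x + y)].
  by exists x => // i; rewrite -[x]addr0; exact: xA.
elim=> [_|m IH mn].
  exists 0, setT; split=> //; last by rewrite normr0 powR0 ?gt_eqF// mul0r addr0.
  by exists 0%N, (fun _ => 0) => x; exists (fun _ => 0).
have [x [Y [lY cY fY xa xA]]] := IH (ltnW mn).
pose i0 := Ordinal mn.
have [x' [Yx' x'a nA]] : exists x', [/\ Y (x' - x),
    `|x'| `^ p < a + m.+1%:R * r `^ p & ~ A i0 x'].
  have [Ax|nAx] := pselect (A i0 x); last first.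
    exists x; split=> //; first by rewrite subrr; case: lY.
    by apply: lt_le_trans xa _; rewrite lerD2l ler_wpM2r ?powR_ge0// ler_nat.
  have [N xN] := lt_norm_add_tail p1 (ltW r0) xa.
  have [Z [ZY lZ cZ fZ Z0]] := tail_subspace _ N lY cY fY.
  have [y [Zy y1 nAy]] := essential_inradius_escape r0 (Ar i0) Ax lZ cZ fZ.
  exists (x + r *: y); split=> //.
    by rewrite addrC addKr; apply/ZY; exact: linear_subspaceZ.
  rewrite -[m.+1]addn1 natrD mulrDl mul1r addrA; apply: xN => [k kN|].
    by rewrite lpZ (Z0 _ Zy)// mulr0.
  by rewrite normrZ gtr0_norm// ger_pMr.
have [H [lH cH fH HA]] := separation (clA i0) (cvA i0) nA.
exists x', (Y `&` H); split=> //.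
- exact: linear_subspaceI.
- exact: closedI.
- exact: finite_codimI.
- move=> i; rewrite ltnS leq_eqVlt => /orP[/eqP im|im] y [Yy Hy].
    have -> : i = i0 by exact: val_inj.
    exact: HA.
  rewrite -[x'](subrK x) addrAC addrC; apply: xA => //.
  exact: linear_subspaceD.
Qed.

(** The radius r is chosen such that n r^p = 1/2, and the other half of the unit is
    the initial margin a in [avoid_sets]. *)
Lemma covering_index_ge (n : nat) : (0 < n)%N ->
  (((2^-1 `^ p^-1) * n%:R `^ (- p^-1))%:E <= covering_index lp n)%E.
Proof.
move=> n0; set r := _ * _.
have n0' : 0 < n%:R :> R by rewrite ltr0n.
have r0 : 0 < r by rewrite mulr_gt0// powR_gt0.
have rp : n%:R * r `^ p = 2^-1.
  rewrite /r powRM ?powR_ge0// -!powRrM mulNr mulVf ?gt_eqF// powRN !powRr1 ?ltW//.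
  by rewrite mulrCA mulfV ?mulr1// gt_eqF.
apply: le_ereal_inf_tmp => _ [A [cA Acov] <-].
rewrite leNgt; apply/negP => Ar.
have [||||x xa nAx] := @avoid_sets n A 2^-1 r _ r0.
- by rewrite invr_gt0.
- by move=> i; have [] := cA i.
- by move=> i; have [] := cA i.
- by move=> i; apply: le_lt_trans Ar; exact: le_bigmax.
have : unit_ball x.
  rewrite /unit_ball/= -(ler_powR_base p1)// powR1 ltW//.
  by apply: lt_le_trans xa _; rewrite rp; lra.
by rewrite -Acov => -[i _]; exact: nAx.
Qed.

End bounds.

Theorem corollary4p2 (R : realType) (p : R) (p1 : 1 <= p) :
  exists c d : R, [/\ 0 < c, 0 < d & forall n : nat, (0 < n)%N ->
    ((c * n%:R `^ (- p^-1))%:E <= covering_index (lp p1) n /\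
     covering_index (lp p1) n <= (d * n%:R `^ (- p^-1))%:E)%E].
Proof.
exists (2^-1 `^ p^-1), 1; split=> [||n n0].
- by rewrite powR_gt0// invr_gt0.
- exact: ltr01.
- by rewrite mul1r; split; [exact: covering_index_ge|exact: covering_index_le].
Qed.
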